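(* Each countably infinite transcendental group is a member of one of the following three classes of countably infinite transcendental groups, and each class has exactly $\mathfrak{c}$ members: the first class consists of those isomorphic as a topological group to the discrete group $\mathbb{Z}$ of integers; the second class consists of those isomorphic as a topological group to the discrete group $\mathbb{Z}\times\mathbb{Z}$; the third class consists of those homeomorphic to the topological space $\mathbb{Q}$ of all rational numbers.
   Context: $\mathbb{C}$ denotes the additive topological group of complex numbers with its euclidean topology. A transcendental group is a subgroup $G$ of the topological group $\mathbb{C}$ (with the subspace topology) such that every element of $G$ except $0$ is a transcendental number. $\mathfrak{c}$ is the cardinality of the continuum. $\mathbb{Q}$ has its usual topology as a subspace of $\mathbb{R}$. Members of a class are counted as distinct subgroups of $\mathbb{C}$. *)

(* Defs.v *)
From HB Require Import structures.
From mathcomp Require Import all_boot all_order all_algebra complex.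
From mathcomp Require Import all_classical all_reals all_analysis.

Set Implicit Arguments.
Unset Strict Implicit.
Unset Printing Implicit Defensive.

Import Order.TTheory GRing.Theory Num.Theory.
Import numFieldNormedType.Exports.

Local Open Scope classical_set_scope.
Local Open Scope card_scope.
Local Open Scope ring_scope.
Local Open Scope complex_scope.

Section DiscreteGroup.
Variable M : zmodType.
Local Notation D := (discrete_topology M).

HB.instance Definition _ := GRing.Zmodule.on D.

Let discrete_sub_continuous : continuous (fun x : D * D => x.1 - x.2).
Proof.
move=> [a b] U /nbhs_singleton Uab.
exists ([set a], [set b]); first by split; exact: discrete_set1.
by move=> [x y] [/= -> ->].
Qed.

HB.instance Definition _ := PreTopologicalNmodule_isTopologicalZmodule.Build D
  discrete_sub_continuous.

End DiscreteGroup.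

Section Homeomorphism.
Variables X Y : topologicalType.

Definition homeomorphism (f : X -> Y) : Prop :=
  continuous f /\
  exists g : Y -> X, [/\ cancel f g, cancel g f & continuous g].

Definition homeomorphic : Prop := exists f : X -> Y, homeomorphism f.

End Homeomorphism.

(* The coercion set_type turns a set into its sigma type, which carries the
   subspace topology. Only used when G is a subgroup of V: its group law is
   then the restriction of the one of V, hence the morphism condition is
   stated through the inclusion \val. *)
Definition topgroup_isomorphic (A V : topologicalZmodType) (G : set V) : Prop :=
  exists f : A -> G, homeomorphism f /\ {morph \val \o f : a b / a + b}.

Section Transcendental.
Variable R : realType.

(* The numClosedFieldType coercion gives access to the topology of the modulus,
   for which the bare type R[i] has no canonical instance. *)
Definition Cplx : numClosedFieldType := R[i].

Definition transcendental (z : Cplx) : Prop :=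
  ~ algebraicOver (ratr : rat -> Cplx) z.

Definition transcendental_group (G : set Cplx) : Prop :=
  zmod_closed (mem G) /\ (forall z, G z -> z != 0 -> transcendental z).

Definition ctransc_groups : set (set Cplx) :=
  [set G | transcendental_group G /\ G #= [set: nat]].

Definition class_Z : set (set Cplx) :=
  [set G | ctransc_groups G /\ topgroup_isomorphic (discrete_topology int) G].

Definition class_ZxZ : set (set Cplx) :=
  [set G | ctransc_groups G /\
           topgroup_isomorphic (discrete_topology (int * int)%type) G].

(* The space of rationals is the subspace range ratr of R. *)
Definition class_Q : set (set Cplx) :=
  [set G | ctransc_groups G /\ homeomorphic G (range (ratr : rat -> R))].

End Transcendental.

Arguments class_Z : clear implicits.
Arguments class_ZxZ : clear implicits.
Arguments class_Q : clear implicits.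
Arguments ctransc_groups : clear implicits.

(* Main.v *)
Require Import Defs.
From mathcomp Require Import all_boot all_order all_algebra complex.
From mathcomp Require Import all_classical all_reals all_analysis.
From mathcomp Require Import ring lra.

(* Let G be a countably infinite transcendental group. If 0 is isolated in G,
   then G is a lattice of rank 1 or 2. Otherwise G is a countable metrizable
   space without isolated points, and such a space is homeomorphic to Q by
   Sierpinski's theorem: clopen sets are split in two repeatedly, each time
   isolating a shrinking neighbourhood of the first remaining point of an
   enumeration, which identifies the space with the set of eventually zero
   binary sequences.

   For the cardinalities, there are only continuum many sequences of complex
   numbers. Conversely, for A = Z, Z[i] or Q and t a transcendental real, the
   group A(1 + it) lies in the corresponding class and determines t. *)

Set Implicit Arguments.
Unset Strict Implicit.
Unset Printing Implicit Defensive.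

Import Order.TTheory GRing.Theory Num.Theory.
Import numFieldNormedType.Exports.

Local Open Scope classical_set_scope.
Local Open Scope card_scope.
Local Open Scope ring_scope.
Local Open Scope complex_scope.

(** * Sierpinski's theorem *)

Section BinaryCoding.
Variables (X : topologicalType) (e : X -> nat) (B : X -> nat -> set X).
Hypothesis e_inj : injective e.
Hypothesis B_nbhs : forall x n, nbhs x (B x n).
Hypothesis B_base : forall x V, nbhs x V ->
  exists N, forall n, (N <= n)%N -> B x n `<=` V.
Hypothesis X_T1 : forall x y : X, x != y -> exists2 V, nbhs x V & ~ V y.
Hypothesis X_clopen : forall x (V : set X), nbhs x V ->
  exists U, [/\ clopen U, U x & U `<=` V].
Hypothesis X_perfect : forall x (V : set X), nbhs x V -> exists2 y, V y & y != x.
Variable x0 : X.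

Lemma exists_least (U : set X) : U !=set0 ->
  exists2 x, U x & forall y, U y -> (e x <= e y)%N.
Proof.
move=> [y Uy].
have ex : exists n, `[< exists2 z, U z & e z = n >].
  by exists (e y); apply/asboolP; exists y.
case: (ex_minnP ex) => n /asboolP[z Uz ezn] nmin.
by exists z => // w Uw; rewrite ezn; apply: nmin; apply/asboolP; exists w.
Qed.

Definition least (U : set X) : X :=
  xget x0 [set x | U x /\ forall y, U y -> (e x <= e y)%N].

Lemma leastP (U : set X) : U !=set0 ->
  U (least U) /\ forall y, U y -> (e (least U) <= e y)%N.
Proof.
move=> /exists_least[x Ux xmin]; rewrite /least.
by case: xgetP => [y _ //|/(_ x)]; case.
Qed.

Lemma least_unique (U : set X) x : U x -> (forall y, U y -> (e x <= e y)%N) ->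
  least U = x.
Proof.
move=> Ux xmin; have [|Ul lmin] := @leastP U; first by exists x.
by apply/e_inj/eqP; rewrite eqn_leq lmin // xmin.
Qed.

(** The half [W] keeps the least point of [U] and shrinks around it as [k] grows. The remainder is
    required to be nonempty so that both pieces can be split again. *)
Definition splits (k : nat) (U W : set X) : Prop :=
  [/\ clopen W, W (least U), W `<=` U `&` B (least U) k & U `\` W !=set0].

(** Perfectness provides a second point [q] in [U]; a clopen neighbourhood of the least point that
    avoids [q] leaves [q] in the remainder. *)
Lemma exists_split k (U : set X) : clopen U -> U !=set0 -> exists W, splits k U W.
Proof.
move=> [oU cU] /leastP[Ul lmin].
have nU : nbhs (least U) U by exact: open_nbhs_nbhs.
have [q Uq ql] := X_perfect nU.
have [|V nV Vq] := X_T1 (x := least U) (y := q); first by rewrite eq_sym.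
have /X_clopen[W [cW Wl sW]] : nbhs (least U) (U `&` B (least U) k `&` V).
  by do 2 apply: filterI => //.
exists W; split => //; first by move=> x /sW[].
by exists q; split => // /sW[].
Qed.

Definition half (k : nat) (U : set X) : set X := xget set0 (splits k U).

Lemma halfP k (U : set X) : clopen U -> U !=set0 -> splits k U (half k U).
Proof.
move=> cU /(exists_split k cU)[W sW]; rewrite /half.
by case: xgetP => // /(_ W).
Qed.

(** The bit [false] goes to the half with the least point, so a branch that keeps following a least
    point is eventually zero. *)
Definition child (k : nat) (U : set X) (b : bool) : set X :=
  if b then U `\` half k U else half k U.

Lemma childP k U b : clopen U -> U !=set0 ->
  clopen (child k U b) /\ child k U b !=set0.
Proof.
move=> cU U0; have [cH Hl HU UH] := halfP k cU U0.
case: b => /=; last by split => //; exists (least U).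
split => //; rewrite setDE; apply: clopenI => //.
exact: clopenC set0 cH.
Qed.

Lemma child_sub k U b : clopen U -> U !=set0 -> child k U b `<=` U.
Proof.
move=> cU U0; have [_ _ HU _] := halfP k cU U0.
by case: b => x /=; [case|move=> /HU[]].
Qed.

Fixpoint node (s : nat -> bool) (n : nat) : set X :=
  if n is m.+1 then child m (node s m) (s m) else setT.

Lemma nodeP s n : clopen (node s n) /\ node s n !=set0.
Proof.
elim: n => [|n [cn n0]] /=; last exact: childP.
by split; [exact: clopenT|exists x0].
Qed.

Lemma node_le s m n : (m <= n)%N -> node s n `<=` node s m.
Proof.
move=> /subnK <-; elim: (n - m)%N => // k IH; rewrite addSn.
apply: subset_trans IH; rewrite [X in X `<=` _]/=.
by have [? ?] := nodeP s (k + m)%N; exact: child_sub.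
Qed.

Lemma eq_node s t n : (forall i, (i < n)%N -> s i = t i) -> node s n = node t n.
Proof.
elim: n => // n IH H /=; rewrite IH ?H // => i lin; apply: H.
exact: ltn_trans lin _.
Qed.

(** The two children of a node are disjoint, so two paths through [x] cannot part. *)
Lemma node_eq s t n x : node s n x -> node t n x ->
  forall i, (i < n)%N -> s i = t i.
Proof.
elim: n => // n IH sx tx i.
have sxn : node s n x by apply: (@node_le s n n.+1).
have txn : node t n x by apply: (@node_le t n n.+1).
have st := IH sxn txn.
rewrite ltnS leq_eqVlt => /predU1P[->|]; last exact: st.
move: sx tx => /=; rewrite (eq_node st) /child.
by case: (s n); case: (t n) => //=; [case=> _ h /h|move=> h [_ /(_ h)]].
Qed.

(** The bit of [x] at level [n] depends on the node reached there, which depends on the earlier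
    bits. This recursion on nodes breaks the circle; [branch_nodeE] then identifies it with
    [node (branch x)]. *)
Fixpoint branch_node (x : X) (n : nat) : set X :=
  if n is m.+1 then
    child m (branch_node x m) (~~ `[< half m (branch_node x m) x >])
  else setT.

Definition branch (x : X) (n : nat) : bool := ~~ `[< half n (branch_node x n) x >].

Lemma branch_nodeE x n : branch_node x n = node (branch x) n.
Proof. by elim: n => // n IH; rewrite [RHS]/= -IH. Qed.

Lemma branchE x n : branch x n = ~~ `[< half n (node (branch x) n) x >].
Proof. by rewrite /branch branch_nodeE. Qed.

Lemma node_branch x n : node (branch x) n x.
Proof.
elim: n => //= n IH; rewrite branchE /child.
by case: asboolP.
Qed.

Lemma branch_nodeP s n x : node s n x <-> forall i, (i < n)%N -> branch x i = s i.
Proof.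
split; first by move=> sx; apply: node_eq sx; exact: node_branch.
by move=> /eq_node <-; exact: node_branch.
Qed.

Lemma branch_continuous x n : \forall y \near x, forall i, (i < n)%N -> branch y i = branch x i.
Proof.
have [[on _] _] := nodeP (branch x) n.
have : nbhs x (node (branch x) n) by apply: open_nbhs_nbhs; split => //; exact: node_branch.
by apply: filterS => y /branch_nodeP.
Qed.

Lemma node_least_le s m n : (m <= n)%N -> (e (least (node s m)) <= e (least (node s n)))%N.
Proof.
move=> mn; have [_ /leastP[_ h]] := nodeP s m; apply: h.
by apply: (node_le mn); have [_ /leastP[]] := nodeP s n.
Qed.

(* Along the branch of x the rank of the least point is nondecreasing and at
   most e x, so it stabilises at some p; from then on x and p lie in the same
   half, which shrinks to p. *)
Lemma branch_eventually x : exists N, forall n, (N <= n)%N ->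
  least (node (branch x) n) = x /\ branch x n = false.
Proof.
pose a n := e (least (node (branch x) n)).
have a_le n : (a n <= e x)%N.
  by have [_ /leastP[_]] := nodeP (branch x) n; apply; exact: node_branch.
have [N Nmax] : exists N, forall n, (N <= n)%N -> a n = a N.
  have exa : exists k, `[< exists n, a n = k >] by exists (a 0%N); apply/asboolP; exists 0%N.
  have bnd k : `[< exists n, a n = k >] -> (k <= e x)%N.
    by move=> /asboolP[n <-].
  case: (ex_maxnP exa bnd) => k /asboolP[N aN] kmax.
  exists N => n Nn; apply/eqP; rewrite eqn_leq [X in _ && X]node_least_le // andbT aN.
  by apply: kmax; apply/asboolP; exists n.
set p := least (node (branch x) N).
have pE n : (N <= n)%N -> least (node (branch x) n) = p.
  by move=> /Nmax /e_inj.
have x_half n : (N <= n)%N -> branch x n = false.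
  move=> Nn; have [cn n0] := nodeP (branch x) n.
  have [_ hl _ _] := halfP n cn n0; rewrite pE // in hl.
  have [_ /leastP[]] := nodeP (branch x) n.+1.
  rewrite pE ?leqW //= /child; case: (branch x n) => //.
  by move=> [_ /(_ hl)].
have xB n : (N <= n)%N -> B p n x.
  move=> Nn; have := node_branch x n.+1; rewrite /= x_half //=.
  have [cn n0] := nodeP (branch x) n; have [_ _ + _] := halfP n cn n0.
  by rewrite pE // => /[apply] -[].
have px : p = x.
  apply/eqP/negP => /negP/X_T1[V nV]; apply.
  have [M BV] := B_base nV.
  by apply: (BV (maxn M N)); [exact: leq_maxl|apply: xB; exact: leq_maxr].
by exists N => n Nn; rewrite pE // px x_half.
Qed.

Lemma branch_basis x (V : set X) : nbhs x V ->
  exists n, forall y, (forall i, (i < n)%N -> branch y i = branch x i) -> V y.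
Proof.
move=> /B_base[M BV]; have [N xN] := branch_eventually x.
set m := maxn M N; have [|xl xc] := xN m; first exact: leq_maxr.
(* The set inside [B x m] is the half of the node at level [m], and entering that half takes one
   more bit. *)
exists m.+1 => y /branch_nodeP; rewrite /= xc /=.
have [cn n0] := nodeP (branch x) m; have [_ _ + _] := halfP m cn n0.
by move=> /[apply] -[_]; rewrite xl; apply: BV; exact: leq_maxl.
Qed.

Lemma branch_inj : injective branch.
Proof.
move=> x y xy; apply/eqP/negP => /negP/X_T1[V /branch_basis[n nV]]; apply.
by apply: nV => i _; rewrite xy.
Qed.

(** Take the least point of the node at level [N]. All later bits choose the half that contains it,
    so it stays the least point and lies in every node. *)
Lemma branch_surj (s : nat -> bool) N : (forall n, (N <= n)%N -> s n = false) ->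
  exists x, branch x = s.
Proof.
move=> s0; exists (least (node s N)); set x := least _.
have xE k : least (node s (N + k)) = x.
  elim: k => [|k IH]; first by rewrite addn0.
  have [cn n0] := nodeP s (N + k)%N.
  have [_ hl _ _] := halfP (N + k)%N cn n0.
  have /= := @node_le s (N + k) (N + k).+1 (leqnSn _).
  rewrite addnS /= s0 ?leq_addr //= => sub; rewrite IH in hl.
  apply: least_unique => // y /sub; rewrite -IH.
  by have [_] := leastP n0; apply.
have x_node m : node s m x.
  apply: (@node_le s m (N + m)); first exact: leq_addl.
  by rewrite -(xE m); have [_ /leastP[]] := nodeP s (N + m)%N.
by apply/funext => n; have /branch_nodeP := x_node n.+1; apply.
Qed.

End BinaryCoding.

(** Such a [c] is a homeomorphism onto the eventually zero sequences, as a subspace of Cantor space;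
    the last two clauses are the continuity of [c] and of its inverse. *)
Definition eventually_zero_coding (X : topologicalType) (c : X -> nat -> bool) : Prop :=
  [/\ injective c,
      forall s, (exists x, c x = s) <-> exists N, forall n, (N <= n)%N -> s n = false,
      (forall x n, \forall y \near x, forall i, (i < n)%N -> c y i = c x i) &
      forall x (V : set X), nbhs x V ->
        exists n, forall y, (forall i, (i < n)%N -> c y i = c x i) -> V y].

(** Both codings have the same image, so points with equal codes can be matched. *)
Lemma coding_homeomorphic (X Y : topologicalType) c d :
  @eventually_zero_coding X c -> @eventually_zero_coding Y d -> homeomorphic X Y.
Proof.
move=> [cI cs cc cb] [dI ds dc db].
have /choice[f fE] x : exists y, d y = c x by apply/ds/cs; exists x.
have /choice[g gE] y : exists x, c x = d y by apply/cs/ds; exists y.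
exists f; split.
  move=> x V /db[n nV].
  by apply: filterS (cc x n) => z zx; apply: nV => i /zx; rewrite !fE.
exists g; split.
- by move=> x; apply: cI; rewrite gE fE.
- by move=> y; apply: dI; rewrite fE gE.
- move=> y V /cb[n nV].
  by apply: filterS (dc y n) => z zx; apply: nV => i /zx; rewrite !gE.
Qed.

(** * Countable subspaces without isolated points *)

Lemma nbhs_set_typeP (K : numFieldType) (A : set K) (x : A) (V : set A) :
  nbhs x V <->
  exists2 r : K, 0 < r & forall y : A, `|\val x - \val y| < r -> V y.
Proof.
split.
  move=> [_ [[W oW <-] /= Wx WV]].
  have /nbhs_ballP[r /= r0 rW] : nbhs (set_val x) W by exact: open_nbhs_nbhs.
  by exists r => // y xy; apply: WV => /=; apply: rW.
move=> [r r0 rV].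
have : nbhs (set_val x) (ball (set_val x) r) by exact: nbhsx_ballx.
move=> /(@initial_continuous A K set_val x); apply: (@filterS A (nbhs x)) => y.
exact: rV.
Qed.

(** A ball whose bounding sphere misses [A] is also closed in [A]. The order of [K] may be partial,
    hence the condition that [r] is real. *)
Lemma set_type_clopen (K : numFieldType) (A : set K) (x : A) (r : K) :
  r \is Num.real ->
  (forall y : A, `|\val x - \val y| != r) ->
  clopen [set y : A | `|\val x - \val y| < r].
Proof.
move=> rr xr; split.
  rewrite openE => y /= yr; apply/nbhs_set_typeP.
  exists (r - `|\val x - \val y|); first by rewrite subr_gt0.
  move=> z yz /=; rewrite -(subrK (\val y) (\val x)) -addrA.
  by apply: (le_lt_trans (ler_normD _ _)); rewrite [ltLHS]addrC -ltrBrDr.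
rewrite -openC openE => y /= /negP.
rewrite -real_leNgt // ?normr_real// le_eqVlt eq_sym (negbTE (xr y)) /= => yr.
apply/nbhs_set_typeP; exists (`|\val x - \val y| - r); first by rewrite subr_gt0.
move=> z yz /=; apply/negP; rewrite -real_leNgt ?normr_real//.
apply/ltW; rewrite ltrBrDr addrC -ltrBrDr in yz.
apply: lt_le_trans yz _; rewrite lerBlDr.
rewrite -[leLHS]/(`|_|) -(subrK (\val z) (\val x)) -addrA.
by rewrite (le_trans (ler_normD _ _))// lerD2l distrC.
Qed.

(** Stated over [K] so as to serve for the rationals in the real line and for groups in the complex
    plane. The first two hypotheses supply countable neighbourhood bases and radii that avoid
    countably many values. *)
Lemma perfect_coding (K : numFieldType) (A : set K) :
  (forall e : K, 0 < e -> exists n, n.+1%:R^-1 < e) ->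
  (forall (C : set K) (e : K), countable C -> 0 < e ->
    exists r, [/\ 0 < r, r < e & ~ C r]) ->
  countable A -> A !=set0 ->
  (forall x (e : K), A x -> 0 < e -> exists y, [/\ A y, y != x & `|x - y| < e]) ->
  exists c, @eventually_zero_coding A c.
Proof.
move=> arch avoid /countable_injP[f finj] [a Aa] perf.
pose e (x : A) := f (\val x).
have eI : injective e.
  by move=> x y /finj xy; apply: val_inj; apply: xy; exact: valP.
pose B (x : A) n := [set y : A | `|\val x - \val y| < n.+1%:R^-1].
have BN x n : nbhs x (B x n) by apply/nbhs_set_typeP; exists n.+1%:R^-1.
have BB x V : nbhs x V -> exists N, forall n, (N <= n)%N -> B x n `<=` V.
  move=> /nbhs_set_typeP[r /arch[N Nr] rV]; exists N => n Nn y /= xy.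
  apply: rV; apply: lt_trans Nr; apply: lt_le_trans xy _.
  by rewrite lef_pV2 ?posrE ?ltr0Sn// ler_nat.
have T1 (x y : A) : x != y -> exists2 V, nbhs x V & ~ V y.
  move=> xy; exists [set z : A | `|\val x - \val z| < `|\val x - \val y|].
    apply/nbhs_set_typeP; exists `|\val x - \val y| => //.
    by rewrite normr_gt0 subr_eq0; apply: contra xy => /eqP/val_inj ->.
  by rewrite /= ltxx.
have clop (x : A) (V : set A) : nbhs x V -> exists U, [/\ clopen U, U x & U `<=` V].
  move=> /nbhs_set_typeP[r r0 rV].
  (* Only countably many distances from [x] occur, so some radius below [r] is none of them and
     gives a clopen ball. *)
  have cC : countable [set `|\val x - \val y| | y in [set: A]].
    apply: sub_countable (card_image_le _ _) _; apply/countable_injP.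
    by exists e => y z _ _; exact: eI.
  have [s [s0 sr sC]] := avoid _ _ cC r0.
  exists [set y : A | `|\val x - \val y| < s]; split.
  - apply: set_type_clopen; first exact: gtr0_real.
    by move=> y; apply/eqP => ys; apply: sC; exists y.
  - by rewrite /= subrr normr0.
  - by move=> y /= /lt_trans/(_ sr); exact: rV.
have pf (x : A) (V : set A) : nbhs x V -> exists2 y, V y & y != x.
  move=> /nbhs_set_typeP[r r0 rV].
  have [y [Ay yx xy]] := perf (\val x) r (set_valP x) r0.
  exists (SigSub (mem_set Ay)); first exact: rV.
  by apply: contra yx => /eqP <-.
pose x0 : A := SigSub (mem_set Aa).
exists (branch e B x0); split.
- exact: branch_inj.
- move=> s; split; last by move=> [N]; exact: branch_surj.
  move=> [x <-]; have [N xN] := branch_eventually eI BN BB T1 clop pf x0 x.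
  by exists N => n /xN[].
- exact: branch_continuous.
- exact: branch_basis.
Qed.

(** * Cardinalities *)

(** Otherwise [C] would contain an interval of Lebesgue measure [e], while countable sets have
    measure zero. *)
Lemma countable_avoid (R : realType) (C : set R) (e : R) :
  countable C -> 0 < e -> exists r, [/\ 0 < r, r < e & ~ C r].
Proof.
move=> cC e0; apply: contrapT => nex.
have sub : [set` `]0, e[] `<=` C.
  move=> r /=; rewrite in_itv /= => /andP[r0 re].
  by apply: contrapT => nCr; apply: nex; exists r.
have /countable_lebesgue_measure0 : countable [set` `]0, e[].
  exact: sub_countable (subset_card_le sub) cC.
rewrite lebesgue_measure_itv /= lte_fin e0 sube0 => -[e_eq0].
by rewrite e_eq0 ltxx in e0.
Qed.

Lemma countable_avoidC (R : realType) (C : set (Cplx R)) (e : Cplx R) :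
  countable C -> 0 < e -> exists r, [/\ 0 < r, r < e & ~ C r].
Proof.
move=> cC; rewrite ltcE /= => /andP[/eqP e0 re0].
have cC' : countable [set x : R | C x%:C].
  apply: sub_countable cC; apply: card_ge_preimage.
  by move=> x y _ _; exact: complexI.
have [r [r0 re nCr]] := countable_avoid cC' re0.
by exists r%:C; split => //; rewrite ltcE /= ?eqxx// e0 eqxx.
Qed.

Lemma uncountable_real (R : realType) : ~ countable [set: R].
Proof. by move=> /countable_avoid /(_ ltr01)[r [_ _]]; apply. Qed.

(** * Real numbers and bit sequences *)

Section RealsAndBits.
Variable R : realType.

(** Base 3 with digits 0 and 1: all digits after a given place together contribute at most half a
    unit of that place, so distinct sequences have distinct sums. *)
Definition bit_sum (b : nat -> bool) (n : nat) : R :=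
  \sum_(i < n) (b i)%:R / 3 ^+ i.+1.

(** The upper bound is the geometric sum obtained when the [k] added digits are all 1. *)
Lemma bit_sum_le b n k : bit_sum b n <= bit_sum b (n + k) <=
  bit_sum b n + (3 ^- n - 3 ^- (n + k)) / 2.
Proof.
elim: k => [|k /andP[IH1 IH2]]; first by rewrite addn0 subrr mul0r addr0 lexx.
rewrite addnS /bit_sum big_ord_recr /= -!/(bit_sum _ _).
have p0 : 0 < (3 : R) ^- (n + k).+1 by rewrite invr_gt0 exprn_gt0.
have pE : (3 : R) ^- (n + k) = 3 * 3 ^- (n + k).+1.
  by rewrite exprS invfM mulrA mulfV ?mul1r.
have b0 : 0 <= (b (n + k)%N)%:R / 3 ^+ (n + k).+1 :> R.
  by rewrite mulr_ge0 ?ler0n// ltW.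
have b1 : (b (n + k)%N)%:R / 3 ^+ (n + k).+1 <= 3 ^- (n + k).+1 :> R.
  by case: (b _); rewrite ?mul1r // mul0r ltW.
rewrite pE in IH2.
apply/andP; split; lra.
Qed.

Definition bits_real (b : nat -> bool) : R := sup (range (bit_sum b)).

Lemma bits_real_bounds b n :
  bit_sum b n <= bits_real b <= bit_sum b n + 3 ^- n / 2.
Proof.
have ub : ubound (range (bit_sum b)) (bit_sum b n + 3 ^- n / 2).
  move=> _ [m _ <-]; have p0 k : 0 < (3 : R) ^- k by rewrite invr_gt0 exprn_gt0.
  have [nm|/ltnW mn] := leqP n m.
    have /andP[_] := bit_sum_le b n (m - n); rewrite subnKC // => /le_trans; apply.
    by rewrite lerD2l ler_pM2r // gerBl ltW.
  have /andP[+ _] := bit_sum_le b m (n - m); rewrite subnKC // => /le_trans; apply.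
  by rewrite lerDl divr_ge0 // ltW.
apply/andP; split; last by apply: ge_sup => //; exists (bit_sum b 0); exists 0%N.
by apply: ub_le_sup; [exists (bit_sum b n + 3 ^- n / 2)|exists n].
Qed.

Lemma bits_real_lt (b c : nat -> bool) n : (forall i, (i < n)%N -> b i = c i) ->
  b n -> ~~ c n -> bits_real c < bits_real b.
Proof.
move=> bc bn cn.
have sE : bit_sum b n = bit_sum c n by apply: eq_bigr => i _; rewrite bc.
have /andP[+ _] := bits_real_bounds b n.+1.
have /andP[_] := bits_real_bounds c n.+1.
rewrite /bit_sum !big_ord_recr /= -!/(bit_sum _ _) bn (negbTE cn) sE.
rewrite mul0r addr0 mul1r.
have p0 : 0 < (3 : R) ^- n.+1 by rewrite invr_gt0 exprn_gt0.
lra.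
Qed.

Lemma bits_real_inj : injective bits_real.
Proof.
move=> b c bc; apply/funext => n; apply: contrapT => bcn.
have ex : exists n, b n != c n by exists n; exact/eqP.
case: (ex_minnP ex) => m bcm mmin.
have agree i : (i < m)%N -> b i = c i.
  by move=> im; apply/eqP/negPn/negP => /mmin; rewrite leqNgt im.
have agree' i : (i < m)%N -> c i = b i by move=> /agree.
case bm: (b m) bcm; case cm: (c m) => // _.
  by have := bits_real_lt agree bm (negbT cm); rewrite bc ltxx.
by have := bits_real_lt agree' cm (negbT bm); rewrite bc ltxx.
Qed.

(** The Dedekind cut of [x], read along an enumeration of the rationals. *)
Definition real_bits (x : R) (n : nat) : bool :=
  if @choice.unpickle rat n is Some q then ratr q < x else false.

Lemma real_bits_inj : injective real_bits.
Proof.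
move=> x y xy; apply/eqP; rewrite eq_le !leNgt; apply/andP; split; apply/negP.
  move=> /rat_in_itvoo[q]; rewrite in_itv /= => /andP[yq qx].
  have := congr1 (fun f => f (choice.pickle q)) xy.
  by rewrite /real_bits pickleK qx ltNge (ltW yq).
move=> /rat_in_itvoo[q]; rewrite in_itv /= => /andP[xq qy].
have := congr1 (fun f => f (choice.pickle q)) xy.
by rewrite /real_bits pickleK qy ltNge (ltW xq).
Qed.

Lemma bool_family_real (I : countType) : exists f : (I -> bool) -> R, injective f.
Proof.
exists (fun s => bits_real (fun n => if choice.unpickle n is Some i then s i else false)).
move=> s t /bits_real_inj st; apply/funext => i.
by have := congr1 (fun f => f (choice.pickle i)) st; rewrite pickleK.
Qed.

(** Replacing each real by its cut turns the family into bits indexed by [I * nat]. *)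
Lemma real_family_real (I : countType) : exists f : (I -> R) -> R, injective f.
Proof.
have [f fI] := bool_family_real (I * nat)%type.
exists (fun s => f (fun p => real_bits (s p.1) p.2)) => s t /fI st.
apply/funext => i; apply: real_bits_inj; apply/funext => n.
exact: (congr1 (fun g => g (i, n)) st).
Qed.

End RealsAndBits.

(** * Transcendental numbers *)

Section Transcendentals.
Variable R : realType.
Local Notation K := (Cplx R).

Lemma countable_algebraic : countable [set z : K | algebraicOver (ratr : rat -> K) z].
Proof.
pose F (p : {poly rat}) := [set z : K | root (map_poly ratr p) z].
have sub : [set z : K | algebraicOver (ratr : rat -> K) z]
    `<=` \bigcup_(p in [set p | p != 0]) F p.
  by move=> z [p p0 pz]; exists p.
apply: sub_countable (subset_card_le sub) _; apply: bigcup_countable => [|p p0].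
  exact: (@countableP {poly rat}).
apply: finite_set_countable.
have [r rE] := closed_field_poly_normal (map_poly ratr p : {poly K}).
apply: (sub_finite_set (B := [set` r])); last exact: finite_seq.
move=> z; rewrite /F /= rE rootZ ?root_prod_XsubC //.
by rewrite lead_coef_eq0 map_poly_eq0.
Qed.

(** An injective pairing [phi] yields disjoint uncountable sets, one for each [x]. The countably
    many algebraic numbers cannot exhaust any of them. *)
Lemma transcendental_family :
  exists2 t : R -> R, injective t & forall x, transcendental (t x)%:C.
Proof.
have [f fI] := real_family_real R bool.
pose phi (x y : R) := f (fun b => if b then x else y).
have phiI x y x' y' : phi x y = phi x' y' -> x = x' /\ y = y'.
  by move=> /fI st; split; [have := congr1 (@^~ true) st|have := congr1 (@^~ false) st].
have ex x : exists y, transcendental (phi x y)%:C.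
  apply: contrapT => nex; apply: (@uncountable_real R).
  have sub : [set: R] `<=` (fun y => (phi x y)%:C : K) @^-1`
      [set z | algebraicOver (ratr : rat -> K) z].
    by move=> y _; apply: contrapT => ny; apply: nex; exists y.
  apply: sub_countable (subset_card_le sub) _.
  apply: sub_countable countable_algebraic; apply: card_ge_preimage.
  by move=> y z _ _ /complexI/phiI[].
have /choice[u uP] := ex.
exists (fun x => phi x (u x)) => //.
by move=> x y /phiI[].
Qed.

End Transcendentals.

(** * Discrete subgroups of the plane *)

Section PlaneGroups.
Variable R : realType.
Local Notation K := (Cplx R).
Local Notation Re := (@complex.Re R).
Local Notation Im := (@complex.Im R).
Implicit Types (z w g h : K) (S G : set K).

(** The squared modulus with values in [R], whose order is total, whereas [|z|] lies in [K]. *)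
Definition sqnorm z : R := Re z ^+ 2 + Im z ^+ 2.

Lemma sqnormM z w : sqnorm (z * w) = sqnorm z * sqnorm w.
Proof. by case: z w => a b [c d]; rewrite /sqnorm /=; ring. Qed.

Lemma sqnorm_eq0 z : (sqnorm z == 0) = (z == 0).
Proof.
by rewrite /sqnorm paddr_eq0 ?sqr_ge0// !sqrf_eq0 eq_complex.
Qed.

Lemma sqnorm_gt0 z : (0 < sqnorm z) = (z != 0).
Proof. by rewrite lt_def sqnorm_eq0 /sqnorm addr_ge0 ?sqr_ge0 ?andbT. Qed.

Lemma norm_ltC z (r : R) : 0 < r -> (`|z| < r%:C) = (sqnorm z < r ^+ 2).
Proof.
move=> r0; rewrite normc_def ltcR -(ltr_pXn2r (n := 2)) ?nnegrE ?sqrtr_ge0 ?(ltW r0)//.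
by rewrite sqr_sqrtr // addr_ge0 ?sqr_ge0.
Qed.

Definition separated_by (e : R) S :=
  forall z w, S z -> S w -> z != w -> e <= sqnorm (z - w).

Lemma separated_bounded_finite (e M : R) S : 0 < e -> separated_by e S ->
  (forall z, S z -> `|Re z| <= M /\ `|Im z| <= M) -> finite_set S.
Proof.
move=> e0 sepS bdS.
(* This gives [2 * d ^+ 2 <= d < e], so each cell of a square grid of side [d] contains at most one
   point of [S]. *)
pose d := Num.min 1 e / 2.
have d0 : 0 < d by rewrite divr_gt0 // lt_min ltr01.
pose c (x : R) := Num.truncn ((x + M) / d).
have cP (x : R) : `|x| <= M -> (c x)%:R * d <= x + M < (c x).+1%:R * d.
  rewrite ler_norml => /andP[Mx _].
  have : 0 <= (x + M) / d by rewrite divr_ge0 ?(ltW d0)// -lerBlDr sub0r.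
  by move=> /truncn_itv; rewrite ler_pdivlMr // ltr_pdivrMr.
have c_close (x y : R) : `|x| <= M -> `|y| <= M -> c x = c y -> (x - y) ^+ 2 < d ^+ 2.
  move=> /cP + /cP + cxy; rewrite cxy -natr1 mulrDl mul1r.
  move=> /andP[x1 x2] /andP[y1 y2].
  rewrite -[ltLHS]real_normK ?num_real// ltr_pXn2r ?nnegrE ?(ltW d0)//.
  rewrite ltr_norml; apply/andP; split; lra.
pose cc z := (c (Re z), c (Im z)).
have ccI : {in S &, injective cc}.
  move=> z w /set_mem Sz /set_mem Sw [cR cI]; apply/eqP/negP => /negP zw.
  have [zR zI] := bdS _ Sz; have [wR wI] := bdS _ Sw.
  have := sepS _ _ Sz Sw zw.
  have := c_close _ _ zR wR cR; have := c_close _ _ zI wI cI.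
  case: z w {Sz Sw zw cR cI zR zI wR wI} => a b [a' b']; rewrite /sqnorm /=.
  have : d <= 1 / 2 by rewrite ler_pM2r // ge_min lexx.
  have : d <= e / 2 by rewrite ler_pM2r // ge_min lexx orbT.
  nra.
rewrite -(eq_finite_set (inj_card_eq ccI)).
pose N := (Num.truncn ((M + M) / d)).+1.
apply: (sub_finite_set (B := `I_N `*` `I_N)); last first.
  by apply: finite_setX; exact: finite_II.
have c_lt (x : R) : `|x| <= M -> (c x < N)%N.
  move=> xM; rewrite ltnS; apply: le_truncn.
  by rewrite ler_pM2r ?invr_gt0// lerD2r; apply: le_trans (ler_norm _) xM.
by move=> _ [z /bdS[zR zI] <-] /=; split; exact: c_lt.
Qed.

Lemma seq_min (T : eqType) (f : T -> R) (s : seq T) : s != [::] ->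
  exists2 x, x \in s & forall y, y \in s -> f x <= f y.
Proof.
elim: s => // a [|b s] IH _.
  by exists a; rewrite ?mem_head// => y; rewrite inE => /eqP ->.
have [//|x xs xmin] := IH.
have [ax|/ltW xa] := leP (f a) (f x).
  exists a; first exact: mem_head.
  by move=> y; rewrite inE => /predU1P[->//|/xmin]; exact: le_trans.
exists x; first by rewrite inE xs orbT.
by move=> y; rewrite inE => /predU1P[->|/xmin].
Qed.

Lemma exists_min (T : eqType) (f : T -> R) (S : set T) : S !=set0 ->
  (forall x, S x -> finite_set [set y | S y /\ f y <= f x]) ->
  exists2 x, S x & forall y, S y -> f x <= f y.
Proof.
move=> [a Sa] /(_ a Sa)/finite_seqP[s sE].
have as_ : a \in s.
  by have : [set` s] a by rewrite -sE.
have [|x xs xmin] := @seq_min T f s; first by case: s as_ {sE}.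
have [Sx xa] : S x /\ f x <= f a.
  by have : [set` s] x by []; rewrite -sE.
exists x => // y Sy; have [ya|/ltW ay] := leP (f y) (f a).
  by apply: xmin; have : [set` s] y by rewrite -sE.
exact: le_trans ay.
Qed.

Definition discrete_at0 G := exists2 e : R, 0 < e & forall z, G z -> z != 0 -> e <= sqnorm z.

Lemma zmod_closed_setP G : zmod_closed (mem G) <->
  G 0 /\ forall z w, G z -> G w -> G (z - w).
Proof.
split=> -[G0 GB]; split.
- exact: set_mem.
- by move=> z w /mem_set Gz /mem_set Gw; apply: set_mem; exact: GB.
- exact: mem_set.
- by move=> z w /set_mem Gz /set_mem Gw; apply: mem_set; exact: GB.
Qed.

Lemma closed_mulz G z (n : int) : G 0 -> (forall z w, G z -> G w -> G (z - w)) ->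
  G z -> G (n%:~R * z).
Proof.
move=> G0 GB Gz.
have GN w : G w -> G (- w) by rewrite -sub0r; exact: GB.
have Gn (m : nat) : G (m%:R * z).
  elim: m => [|m IH]; first by rewrite mul0r.
  by rewrite -natr1 mulrDl mul1r -[z in _ + z]opprK; apply: GB => //; exact: GN.
case: n => n; first by rewrite -pmulrn.
by rewrite NegzE mulrNz mulNr -pmulrn; exact: GN.
Qed.

(* After scaling a shortest vector to 1, an element of least nonzero imaginary
   part completes 1 to a basis. *)
Lemma discrete_group_basis G :
  zmod_closed (mem G) -> discrete_at0 G -> (exists2 z, G z & z != 0) ->
  exists g, [/\ G g, g != 0 &
    (forall z, G z <-> exists n : int, z = n%:~R * g) \/
    (exists2 h, Im h != 0 & forall z, G z <->
       exists m n : int, z = (m%:~R + n%:~R * h) * g)].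
Proof.
move=> /zmod_closed_setP[G0 GB] [e e0 Ge] [z0 Gz0 z00].
have sepG : separated_by e [set z | G z].
  by move=> z w Gz Gw zw; apply: Ge; [exact: GB|rewrite subr_eq0].
have [g [Gg g0] gmin] : exists2 g, G g /\ g != 0 &
    forall z, G z /\ z != 0 -> sqnorm g <= sqnorm z.
  apply: (@exists_min K sqnorm [set z | G z /\ z != 0]); first by exists z0.
  (* The bound [M] works because every real [a] satisfies [|a| <= a ^+ 2 + 1]. *)
  move=> x _; apply: (separated_bounded_finite (M := sqnorm x + 1) e0).
    by move=> z w [[Gz _] _] [[Gw _] _]; exact: sepG.
  move=> [a b] [_]; rewrite /sqnorm /= !ler_norml => ab.
  by split; apply/andP; split; nra.
exists g; split => //.
pose H := [set x | G (x * g)].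
have H0 : H 0 by rewrite /H /= mul0r.
have H1 : H 1 by rewrite /H /= mul1r.
have HB x y : H x -> H y -> H (x - y) by rewrite /H /= mulrBl; exact: GB.
have Hmin x : H x -> x != 0 -> 1 <= sqnorm x.
  move=> Hx x0; rewrite -(ler_pM2r (_ : 0 < sqnorm g)) ?sqnorm_gt0// mul1r -sqnormM.
  by apply: gmin; split => //; rewrite mulf_neq0.
have HZ (n : int) : H n%:~R by rewrite -[_%:~R]mulr1; exact: closed_mulz.
have intC (n : int) : n%:~R = (n%:~R : R)%:C :> K by rewrite rmorph_int.
(* Subtracting the floor leaves a real element of [[0, 1[], which is zero because nonzero elements
   of [H] have squared norm at least 1. *)
have Hreal x : H x -> Im x = 0 -> exists n : int, x = n%:~R.
  move=> Hx Imx; exists (Num.floor (Re x)); apply/eqP; rewrite -subr_eq0.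
  apply/negPn/negP => /Hmin; rewrite leNgt => /(_ (HB _ _ Hx (HZ _)))/negP; apply.
  have /andP[] := real_floor_itv (num_real (Re x)).
  rewrite intC intrD1; case: x Hx Imx => a b /= _ ->; rewrite /sqnorm /=.
  move: (_%:~R) => r; nra.
have backG z : G z <-> H (z / g) by rewrite /H /= divfK.
have [Hre|] := pselect (forall x, H x -> Im x = 0).
  left=> z; rewrite backG; split.
    by move=> Hz; have [n zn] := Hreal _ Hz (Hre _ Hz); exists n; rewrite -zn divfK.
  by move=> [n ->]; rewrite mulfK.
move=> /existsNP[x1 /not_implyP[Hx1 /eqP x1I]]; right.
(* Integer translations stay in [H] and preserve imaginary parts. Confining the real part makes the
   sets with bounded imaginary part finite, so a minimum exists. *)
pose S := [set x | [/\ H x, Im x != 0, 0 <= Re x & Re x < 1]].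
have toS x : H x -> Im x != 0 -> exists2 y, S y & Im y = Im x.
  move=> Hx xI; exists (x - (Num.floor (Re x))%:~R); last first.
    by rewrite intC; case: x {Hx xI} => a b /=; rewrite subr0.
  split.
  - exact: HB.
  - by rewrite intC; case: x xI {Hx} => a b /=; rewrite subr0.
  - by rewrite intC; case: x {xI Hx} => a b /=; rewrite subr_ge0 floor_le_tmp.
  - rewrite intC; case: x {xI Hx} => a b /=; rewrite ltrBlDr addrC.
    by have /andP[] := real_floor_itv (num_real a); rewrite intrD1.
have [h [Hh hI _ _] hmin] : exists2 h, S h & forall y, S y -> `|Im h| <= `|Im y|.
  apply: (@exists_min K (fun z => `|Im z|)).
    by have [y Sy _] := toS _ Hx1 x1I; exists y.
  move=> x _; apply: (separated_bounded_finite (e := 1) (M := `|Im x| + 1)) => //.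
    by move=> z w [[Hz _ _ _] _] [[Hw _ _ _] _] zw; apply: Hmin; [exact: HB|rewrite subr_eq0].
  move=> z [[_ _ zr0 zr1] zx]; split; last by apply: le_trans zx _; rewrite lerDl.
  by rewrite ger0_norm // (le_trans (ltW zr1))// lerDr.
exists h => // z; rewrite backG; split; last first.
  move=> [m [n ->]]; rewrite mulfK // -[n%:~R]opprK mulNr.
  apply: (HB) => //; rewrite -mulrNz; exact: (@closed_mulz H).
move=> Hz; set x := z / g in Hz *.
pose n := Num.floor (Im x / Im h).
have Hy : H (x - n%:~R * h) by apply: (HB) => //; exact: (@closed_mulz H).
have yI : Im (x - n%:~R * h) = (Im x / Im h - n%:~R) * Im h.
  rewrite mulrBl divfK // intC; case: (x) => a b; case: (h) => c d /=; ring.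
(* This imaginary part is [Im h] times a fractional part, hence smaller in absolute value than the
   least nonzero one. *)
have y0 : Im (x - n%:~R * h) = 0.
  apply/eqP/negPn/negP => /(toS _ Hy)[y Sy yE]; have := hmin _ Sy.
  rewrite yE yI normrM leNgt => /negP; apply.
  rewrite gtr_pMl ?normr_gt0//.
  have /andP[n1 n2] := real_floor_itv (num_real (Im x / Im h)).
  by rewrite ger0_norm ?subr_ge0// ltrBlDr addrC -intrD1.
have [m mE] := Hreal _ Hy y0.
by exists m, n; rewrite -mE subrK divfK.
Qed.

End PlaneGroups.

(** * The three classes *)

Section Classes.
Variable R : realType.
Local Notation K := (Cplx R).
Local Notation Re := (@complex.Re R).
Local Notation Im := (@complex.Im R).
Implicit Types G : set K.

Lemma nbhs_discrete_subgroup G (x : G) : zmod_closed (mem G) -> discrete_at0 G ->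
  nbhs x [set x].
Proof.
move=> /zmod_closed_setP[_ GB] [e e0 Ge]; apply/nbhs_set_typeP.
exists (Num.sqrt e)%:C; first by rewrite ltcR sqrtr_gt0.
move=> y; rewrite norm_ltC ?sqrtr_gt0// sqr_sqrtr ?(ltW e0)// => xy.
apply/val_inj/eqP; rewrite eq_sym -subr_eq0; apply/negPn/negP => /Ge.
by rewrite leNgt xy => /(_ (GB _ _ (set_valP x) (set_valP y))).
Qed.

(** Differences carry the isolation of 0 to every point, so [G] is discrete and an algebraic
    isomorphism is automatically a homeomorphism. *)
Lemma discrete_subgroup_iso (A : zmodType) (f : A -> K) G :
  zmod_closed (mem G) -> discrete_at0 G -> injective f ->
  {morph f : a b / a + b} -> (forall z, G z <-> exists a, z = f a) ->
  topgroup_isomorphic (discrete_topology A) G.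
Proof.
move=> Gz Gd fI fD Gf.
have GfP a : G (f a) by apply/Gf; exists a.
have /choice[k kE] (x : G) : exists a, \val x = f a by apply/Gf; exact: set_valP.
pose f' (a : discrete_topology A) : G := SigSub (mem_set (GfP a)).
exists f'; split; last first.
  by move=> a b; exact: fD.
split.
  move=> a U /nbhs_singleton Ua.
  by apply: (@filterS _ (nbhs a) _ [set a]) (discrete_set1 a) => b ->.
exists k; split.
- by move=> a; apply: fI; rewrite -kE.
- by move=> x; apply: val_inj; rewrite /= -kE.
- move=> x U /nbhs_singleton Ux.
  by apply: filterS (nbhs_discrete_subgroup x Gz Gd) => y ->.
Qed.

Lemma rat_coding : exists c, @eventually_zero_coding (range (ratr : rat -> R)) c.
Proof.
apply: (@perfect_coding R).
- by move=> e e0; exists (Num.truncn e^-1); rewrite invf_plt ?posrE// truncnS_gt.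
- exact: countable_avoid.
- by apply: sub_countable (card_image_le _ _) _; exact: countableP.
- by exists (ratr 0), 0.
- move=> x e _ e0; have [|q] := @rat_in_itvoo _ x (x + e); first by rewrite ltrDl.
  rewrite in_itv /= => /andP[xq qx]; exists (ratr q); split; first by exists q.
    by rewrite gt_eqF.
  by rewrite distrC gtr0_norm ?subr_gt0// ltrBlDl.
Qed.

(** There are arbitrarily short nonzero [z] in [G], and [x - z] is then a point of [G] near [x]. *)
Lemma nondiscrete_coding G : zmod_closed (mem G) -> countable G -> ~ discrete_at0 G ->
  exists c, @eventually_zero_coding G c.
Proof.
move=> /zmod_closed_setP[G0 GB] Gc Gd; apply: (@perfect_coding K) => //.
- move=> e; rewrite ltcE /= => /andP[/eqP e0 e1].
  exists (Num.truncn (Re e)^-1).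
  have -> : (Num.truncn (Re e)^-1).+1%:R^-1 = ((Num.truncn (Re e)^-1).+1%:R^-1)%:C :> K.
    by rewrite fmorphV rmorph_nat.
  by rewrite ltcE /= e0 eqxx /= invf_plt ?posrE// truncnS_gt.
- exact: countable_avoidC.
- by exists 0.
- move=> x e Gx; rewrite ltcE /= => /andP[/eqP Ie e0].
  have [z [Gz z0 ze]] : exists z, [/\ G z, z != 0 & sqnorm z < Re e ^+ 2].
    apply: contrapT => nex; apply: Gd; exists (Re e ^+ 2); first exact: exprn_gt0.
    move=> z Gz z0; rewrite leNgt; apply/negP => ze; apply: nex.
    by exists z.
  exists (x - z); split; first exact: GB.
    by rewrite -subr_eq0 addrAC subrr sub0r oppr_eq0.
  have -> : e = (Re e)%:C by case: e Ie {e0 ze} => a b /= ->.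
  by rewrite subKr norm_ltC.
Qed.

Lemma nondiscrete_homeomorphic G : zmod_closed (mem G) -> countable G ->
  ~ discrete_at0 G -> homeomorphic G (range (ratr : rat -> R)).
Proof.
move=> Gz Gc /(nondiscrete_coding Gz Gc)[c cP].
have [d dP] := rat_coding.
exact: coding_homeomorphic cP dP.
Qed.

Lemma ctransc_groups_classes G : ctransc_groups R G ->
  class_Z R G \/ class_ZxZ R G \/ class_Q R G.
Proof.
move=> cG; have [[Gz _] Gnat] := cG.
have [Gd|Gd] := pselect (discrete_at0 G); last first.
  right; right; split => //; apply: nondiscrete_homeomorphic => //.
  by rewrite (eq_countable Gnat).
have nz : exists2 z, G z & z != 0.
  apply: contrapT => nex; apply: infinite_nat; rewrite -(eq_finite_set Gnat).
  apply: (@sub_finite_set _ _ [set 0]); last exact: finite_set1.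
  by move=> z Gz'; apply/eqP/negPn/negP => z0; apply: nex; exists z.
have [g [_ g0 [GE|[h hI GE]]]] := discrete_group_basis Gz Gd nz.
  left; split => //.
  apply: (@discrete_subgroup_iso int (fun n => n%:~R * g)) => //.
  - by move=> m n /(mulIf g0) /eqP; rewrite eqr_int => /eqP.
  - by move=> m n; rewrite intrD mulrDl.
right; left; split => //.
apply: (@discrete_subgroup_iso (int * int)%type
  (fun p => (p.1%:~R + p.2%:~R * h) * g)) => //.
(* Since [Im h] is nonzero, the imaginary parts determine the second coordinate, and then the real
   parts the first. *)
- move=> [m n] [m' n'] /= /(mulIf g0).
  have intC (k : int) : k%:~R = (k%:~R : R)%:C :> K by rewrite rmorph_int.
  rewrite !intC; case: h hI {GE} => a b /= b0 /eqP.
  rewrite eq_complex /= !mul0r !add0r !addr0 !subr0 => /andP[/eqP mm /eqP /(mulIf b0)/eqP].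
  rewrite eqr_int => /eqP nn; rewrite nn in mm *.
  by move: mm => /addIr /eqP; rewrite eqr_int => /eqP ->.
- by move=> [m n] [m' n'] /=; rewrite !intrD; ring.
- move=> z; rewrite GE; split; first by move=> [m [n ->]]; exists (m, n).
  by move=> [[m n] ->]; exists m, n.
Qed.

(** A countably infinite group is the range of a sequence, whose real and imaginary parts form a
    countable family of reals, coded by a single real. *)
Lemma ctransc_groups_card_le : ctransc_groups R #<= [set: R].
Proof.
have [f fI] := real_family_real R (nat * bool)%type.
have /choice[s sE] G : exists s : nat -> K, ctransc_groups R G -> range s = G.
  have [[_ Gnat]|] := pselect (ctransc_groups R G); last by exists (fun=> 0).
  have /pcard_eqP[b] : [set: nat] #= G by rewrite card_eq_sym.
  exists b => _; apply/seteqP; split; first by move=> _ [n _ <-]; exact: funS.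
  by move=> z Gz; have [n _ <-] := @surj _ _ _ _ b z Gz; exists n.
apply/pcard_injP.
exists (fun G => f (fun p => if p.2 then Re (s G p.1) else Im (s G p.1))).
move=> G H /set_mem cG /set_mem cH /fI sGH.
rewrite -(sE G) // -(sE H) //; suff -> : s G = s H by []; apply/funext => n.
apply/eqP; rewrite eq_complex; apply/andP; split; apply/eqP.
  exact: (congr1 (@^~ (n, true)) sGH).
exact: (congr1 (@^~ (n, false)) sGH).
Qed.

End Classes.

(** * Groups of multiples of [1 +i* t] *)

Section ScaledLines.
Variables (R : realType) (B : zmodType) (p q : B -> rat) (u : B).
Local Notation K := (Cplx R).
Hypothesis B_card : [set: B] #= [set: nat].
Hypothesis pu : p u = 1.
Hypothesis qu : q u = 0.
Hypothesis pB : {morph p : a b / a - b}.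
Hypothesis qB : {morph q : a b / a - b}.
Hypothesis pq_inj : forall a b, p a = p b -> q a = q b -> a = b.

(** The Gaussian rational with coordinates [p b] and [q b]. Suitable choices of [B], [p] and [q]
    give Z, Z[i] and Q at once. *)
Definition gauss (b : B) : K := ratr (p b) +i* ratr (q b).

Definition line_group (t : R) : set K := range (fun b => gauss b * (1 +i* t)).

Lemma gaussB : {morph gauss : a b / a - b}.
Proof.
by move=> a b; rewrite /gauss pB qB !rmorphB.
Qed.

Lemma gauss_inj : injective gauss.
Proof. by move=> a b [/fmorph_inj pab /fmorph_inj qab]; exact: pq_inj. Qed.

Lemma line_neq0 (t : R) : 1 +i* t != 0 :> K.
Proof. by rewrite eq_complex /= oner_eq0. Qed.

Let algebraic_rat x : algebraicOver (ratr : rat -> K) (ratr x : R)%:C.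
Proof.
have -> : (ratr x : R)%:C = ratr x :> K by rewrite fmorph_rat.
exact: algebraic_id.
Qed.

Let algebraic_i : algebraicOver (ratr : rat -> K) 'i.
Proof.
exists ('X^2 + 1); first by rewrite -size_poly_eq0 -[1]/(1%:P) size_XnaddC.
rewrite rmorphD rmorph1 /= map_polyXn rootE !hornerE expr2 eq_complex /=.
by apply/andP; split; apply/eqP; ring.
Qed.

Lemma algebraic_gauss b : algebraicOver (ratr : rat -> K) (gauss b).
Proof.
have -> : gauss b = (ratr (p b))%:C + (ratr (q b))%:C * 'i.
  by apply/eqP; rewrite eq_complex /=; apply/andP; split; apply/eqP; ring.
by apply: algebraic_add => //; apply: algebraic_mul.
Qed.

(* The elements of real part 1 of the group determine t: if
   (x + i y) (1 + i t) has real part 1 then x - y t = 1, and y = 0 as t is irrational. *)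
Lemma line_group_inj (t s : R) : transcendental (t%:C : K) ->
  line_group t = line_group s -> t = s.
Proof.
move=> tt ts; have : line_group s (1 +i* s).
  exists u => //; rewrite /gauss pu qu rmorph1 rmorph0.
  by apply/eqP; rewrite eq_complex /=; apply/andP; split; apply/eqP; ring.
rewrite -ts => -[b _]; rewrite /gauss => /eqP; rewrite eq_complex /= => /andP[/eqP E1 /eqP E2].
have q0 : q b = 0.
  apply/eqP/negPn/negP => q0; apply: tt.
  have -> : t = ratr ((p b - 1) / q b); last exact: algebraic_rat.
  rewrite fmorph_div rmorphB rmorph1; apply: (mulIf (_ : ratr (q b) != 0)).
    by rewrite fmorph_eq0.
  by rewrite divfK ?fmorph_eq0//; lra.
move: E1 E2; rewrite q0 rmorph0 !mul0r subr0 addr0 mulr1 => ->.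
by rewrite mul1r.
Qed.

Lemma line_group_zmod t : zmod_closed (mem (line_group t)).
Proof.
apply/zmod_closed_setP; split.
  exists (u - u) => //.
  by rewrite gaussB subrr mul0r.
by move=> _ _ [a _ <-] [b _ <-]; exists (a - b) => //; rewrite gaussB mulrBl.
Qed.

(** Gaussian rationals and ['i] are algebraic, so an algebraic nonzero element would make [t]
    algebraic after division. *)
Lemma line_group_ctransc t : transcendental (t%:C : K) -> ctransc_groups R (line_group t).
Proof.
move=> tt; split; first split.
- exact: line_group_zmod.
- move=> _ [b _ <-] b0 balg; apply: tt.
  have g0 : gauss b != 0 by apply: contra b0 => /eqP ->; rewrite mul0r.
  have -> : t%:C = (gauss b * (1 +i* t) / gauss b - 1) / 'i :> K.
    rewrite mulrAC divff // mul1r; apply: (mulIf (_ : 'i != 0 :> K)).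
      by rewrite eq_complex /= oner_eq0 andbF.
    rewrite divfK ?eq_complex /= ?oner_eq0 ?andbF//.
    by apply/eqP; rewrite eq_complex /=; apply/andP; split; apply/eqP; ring.
  apply: algebraic_div => //; apply: algebraic_sub; last exact: algebraic1.
  by apply: algebraic_div => //; exact: algebraic_gauss.
- apply: card_eq_trans B_card; apply: inj_card_eq => a b _ _.
  by move=> /(mulIf (line_neq0 t)); exact: gauss_inj.
Qed.

(** The upper bound comes from counting all countable transcendental groups, the lower one from the
    distinct groups of an injective family of transcendental [t]. *)
Lemma line_group_card (C : set (set K)) : C `<=` ctransc_groups R ->
  (forall t, transcendental (t%:C : K) -> C (line_group t)) -> C #= [set: R].
Proof.
move=> Csub Cline; rewrite card_eq_le; apply/andP; split.
  exact: card_le_trans (subset_card_le Csub) (ctransc_groups_card_le R).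
have [t tI tt] := transcendental_family R.
have sub : range (fun x => line_group (t x)) `<=` C.
  by move=> _ [x _ <-]; exact: Cline.
apply: card_le_trans (subset_card_le sub).
have : range (fun x => line_group (t x)) #= [set: R].
  by apply: inj_card_eq => x y _ _ /(line_group_inj (tt x)) /tI.
by rewrite card_eq_le => /andP[].
Qed.

Lemma line_group_iso t : (forall b, gauss b != 0 -> 1 <= sqnorm (gauss b)) ->
  topgroup_isomorphic (discrete_topology B) (line_group t).
Proof.
move=> g1; apply: (@discrete_subgroup_iso R B (fun b => gauss b * (1 +i* t))).
- exact: line_group_zmod.
- exists (sqnorm (1 +i* t : K)); first by rewrite sqnorm_gt0 line_neq0.
  move=> _ [b _ <-] b0; rewrite sqnormM ler_peMl //.
    by rewrite ltW // sqnorm_gt0 line_neq0.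
  by apply: g1; apply: contra b0 => /eqP ->; rewrite mul0r.
- by move=> a b /(mulIf (line_neq0 t)); exact: gauss_inj.
(* Additivity follows from compatibility with differences by writing [a + b] as [a - (0 - b)]. *)
- move=> a b; rewrite -[b in LHS]opprK -[- b]sub0r gaussB gaussB.
  have -> : gauss 0 = 0 by rewrite -[0](subrr 0) gaussB subrr.
  by rewrite sub0r opprK mulrDl.
- by move=> z; split=> [[b _ <-]|[b ->]]; exists b.
Qed.

End ScaledLines.

(** * Cardinality of each class *)

Lemma sqr_ge1 (R : realType) (n : int) : n != 0 -> 1 <= (n%:~R : R) ^+ 2.
Proof.
move=> n0; rewrite -rmorphXn /= -[1]/(1%:~R) ler_int.
by rewrite -gtz0_ge1 exprn_even_gt0.
Qed.

Lemma countType_card_nat (T : countType) (f : nat -> T) : injective f ->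
  [set: T] #= [set: nat].
Proof.
move=> fI; apply: eq_card_nat; first exact: countableP.
move=> fT; apply: infinite_nat.
by apply: (finite_preimage (f := f)) fT => m n _ _; exact: fI.
Qed.

Lemma class_Z_card (R : realType) : class_Z R #= [set: R].
Proof.
have cB : [set: int] #= [set: nat].
  by apply: (@countType_card_nat int Posz) => m n [].
pose p (n : int) : rat := n%:~R; pose q (n : int) : rat := 0.
have pB : {morph p : a b / a - b} by move=> a b; rewrite /p rmorphB.
have qB : {morph q : a b / a - b} by move=> a b; rewrite /q subr0.
have pqI a b : p a = p b -> q a = q b -> a = b by move=> /intr_inj.
apply: (@line_group_card R int p q 1) => //; first by move=> G [].
move=> t tt; split; first exact: (@line_group_ctransc R int p q 1).
apply: (@line_group_iso R int p q 1) => // b.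
rewrite eq_complex /gauss /p /q /= rmorph0 ratr_int eqxx andbT intr_eq0 => b0.
by rewrite /sqnorm /= expr0n /= addr0; exact: sqr_ge1.
Qed.

Lemma class_ZxZ_card (R : realType) : class_ZxZ R #= [set: R].
Proof.
have cB : [set: int * int] #= [set: nat].
  by apply: (@countType_card_nat (int * int)%type (fun n => (n%:Z, 0))) => m n [].
pose p (n : int * int) : rat := n.1%:~R; pose q (n : int * int) : rat := n.2%:~R.
have pB : {morph p : a b / a - b} by move=> a b; rewrite /p rmorphB.
have qB : {morph q : a b / a - b} by move=> a b; rewrite /q rmorphB.
have pqI a b : p a = p b -> q a = q b -> a = b.
  by case: a b => [a a'] [b b'] /intr_inj /= -> /intr_inj /= ->.
apply: (@line_group_card R (int * int)%type p q (1, 0)) => //; first by move=> G [].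
move=> t tt; split; first exact: (@line_group_ctransc R _ p q (1, 0)).
apply: (@line_group_iso R _ p q (1, 0)) => // -[m n].
rewrite eq_complex /gauss /p /q /= !ratr_int !intr_eq0 negb_and /sqnorm /=.
case/orP => /(@sqr_ge1 R) h; first by apply: le_trans h _; rewrite lerDl sqr_ge0.
by apply: le_trans h _; rewrite lerDr sqr_ge0.
Qed.

Lemma class_Q_card (R : realType) : class_Q R #= [set: R].
Proof.
pose p (n : rat) : rat := n; pose q (n : rat) : rat := 0.
have pB : {morph p : a b / a - b} by [].
have qB : {morph q : a b / a - b} by move=> a b; rewrite /q subr0.
have pqI a b : p a = p b -> q a = q b -> a = b by [].
have cB : [set: rat] #= [set: nat] := card_rat.
apply: (@line_group_card R rat p q 1) => //; first by move=> G [].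
move=> t tt; split.
  exact: (@line_group_ctransc R rat p q 1).
apply: nondiscrete_homeomorphic.
- exact: (@line_group_zmod R rat p q 1).
- by apply: sub_countable (card_image_le _ _) _; exact: countableP.
move=> [e e0 /=]; set z : Cplx R := 1 +i* t.
have z0 : 0 < sqnorm z by rewrite sqnorm_gt0 line_neq0.
(* As [r < 1] gives [r ^+ 2 <= r], the nonzero element [r * z] has squared norm below [e], against
   the isolation of 0. *)
have [|r] := @rat_in_itvoo _ 0 (Num.min 1 (e / sqnorm z)).
  by rewrite lt_min ltr01 divr_gt0.
rewrite in_itv /= lt_min (ltr_pdivlMr _ _ z0) => /and3P[r0 r1 re].
move=> /(_ (gauss R p q r * z)).
have gE : gauss R p q r = (ratr r)%:C by rewrite /gauss /p /q rmorph0.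
rewrite sqnormM gE /sqnorm /= expr0n addr0 -/(sqnorm z) => h.
have := h; rewrite leNgt => h'.
have : ~~ (ratr r ^+ 2 * sqnorm z < e).
  by apply: h'; [exists r; rewrite // gE|rewrite mulf_neq0 ?line_neq0// eq_complex /= gt_eqF].
move=> /negP; apply; apply: le_lt_trans re.
by rewrite ler_pM2r // expr2 ger_pMl // ltW.
Qed.

Theorem theorem4p10 (R : realType) :
  (forall G : set (Cplx R), ctransc_groups R G ->
     class_Z R G \/ class_ZxZ R G \/ class_Q R G) /\
  [/\ class_Z R #= [set: R],
      class_ZxZ R #= [set: R]
    & class_Q R #= [set: R] ].
Proof.
split; first exact: ctransc_groups_classes.
by split; [exact: class_Z_card|exact: class_ZxZ_card|exact: class_Q_card].
Qed.
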